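(* Let $q=p^s$ be a prime power ($p$ prime, $s\geq 1$) and let $G=(\mathbb{Z}/q\mathbb{Z})^n$. Let $\delta>0$ and suppose $A\subset G$ has the property that for every $B\subseteq A$ there exists a quasi-independent subset $Q\subseteq B$ with $|Q|\geq\delta|B|$. Then $A$ can be decomposed as a disjoint union $$A=\bigsqcup_{i=1}^k A_i,\qquad k\leq\left\lceil\frac{s\log_2(p)}{\delta}\right\rceil,$$ where each $A_i$ is quasi-independent.
   Context: A subset $Q$ of $G=(\mathbb{Z}/q\mathbb{Z})^n$ is called quasi-independent if the only choice of integer coefficients $\epsilon_a\in\{-1,0,1\}$ ($a\in Q$) satisfying $\sum_{a\in Q}\epsilon_a a=0$ in $G$ is the trivial choice $\epsilon_a=0$ for every $a\in Q$. (In particular a quasi-independent set does not contain $0$, and the empty set is quasi-independent.) *)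

(* Defs.v *)
From HB Require Import structures.
From mathcomp Require Import all_boot all_order all_algebra.
From mathcomp Require Import reals exp.

Set Implicit Arguments.
Unset Strict Implicit.
Unset Printing Implicit Defensive.

Import Order.TTheory GRing.Theory Num.Theory.
Local Open Scope ring_scope.

Definition quasi_independent (G : finZmodType) (Q : {set G}) : Prop :=
  forall eps : G -> int,
    (forall a, a \in Q -> eps a \in [:: -1; 0; 1]) ->
    \sum_(a in Q) a *~ eps a = 0 ->
    forall a, a \in Q -> eps a = 0.

Definition log2 (R : realType) (x : R) : R := ln x / ln 2.

(* Main.v *)
Require Import Defs.
From HB Require Import structures.
From mathcomp Require Import all_boot all_order all_algebra.
From mathcomp Require Import all_fingroup all_solvable.
From mathcomp Require Import zify.
From mathcomp Require Import reals exp.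

(** Why the theorem is true.

    Let k be the ceiling of s log2(p) / delta. If Q is quasi-independent then
    its 2 ^ #|Q| subset sums are distinct elements of <<Q>>, while a subgroup N
    of G has at most p ^ (s * 'r_p(N)) elements. Hence the hypothesis on A
    implies the purely combinatorial condition

      (1)   #|B| <= k * 'r_p(<<B>>)   for every subset B of A,

    where 'r_p(N) is also the dimension of N / pN over F_p. When s = 1 this is
    the condition of Edmonds and Horn for A to split into k linearly
    independent sets. When s > 1 the rank B |-> 'r_p(<<B>>) is not submodular
    (in Z/4 x Z/4 with x = (2, 0), y = (1, 0), z = (1, 2) the ranks of {x},
    {x, y}, {x, z}, {x, y, z} are 1, 1, 1, 2), so matroid theory does not apply
    directly.

    The remedy is to peel A layer by layer (quasi_independent_coloring). Fix
    N = <<A>> and K = pN, which is 'Mho^1(N). Modulo K everything is linear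
    algebra over F_p: the function L(B) = log_p |K + <<B>>| is submodular,
    because |X + Y| |X :&: Y| = |X| |Y| for subgroups, and 'r_p(N) is
    L(A) - L(set0). Among the proper subsets H of A choose one that maximises
    #|H| + k (L(A) - L(H)). By (1) for B = A, the empty set is at least as good
    as A itself, so H is in fact a maximum among all subsets of A, and comparing
    it with H :|: J gives

      #|J| <= k (L(H :|: J) - L(H))   for every J contained in A :\: H.

    Rado's theorem on transversals (rado_transversal), in the form of
    submodular_coloring, now colours A :\: H with k colours so that every
    colour class is independent modulo the subgroup M generated by K and H.
    The set H satisfies (1) and is smaller than A, so by induction it has a
    colouring with quasi-independent classes. Classes of the same colour can be
    merged (independent_mod_setU): in a relation between elements of the union
    the part supported on H lies in M, so the coefficients outside H vanish,
    and then so do those on H. *)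

Set Implicit Arguments.
Unset Strict Implicit.
Unset Printing Implicit Defensive.

Import Order.TTheory GRing.Theory Num.Theory.

Section Coloring.

Local Open Scope group_scope.
Local Open Scope nat_scope.

(** * Transversals and colourings for submodular functions *)

(** Rado's theorem, for a submodular function rather than a matroid rank. As
    long as some S a has two elements x and y, one of them can be removed from
    S a without breaking the Hall condition: if J1 and J2 witnessed the failure
    of the two removals, both would contain a, and submodularity applied to the
    two reduced unions would contradict the condition for J1 :|: J2 or for
    (J1 :&: J2) :\ a. When all S a are singletons, there is nothing left to
    choose. *)
Theorem rado_transversal (T E : finType) (x0 : E) (r : {set E} -> nat)
    (r0 : r set0 = 0)
    (rS : forall X Y : {set E}, X \subset Y -> r X <= r Y)
    (r_submod : forall X Y, r (X :|: Y) + r (X :&: Y) <= r X + r Y)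
    (A : {set T}) (S : T -> {set E}) :
    (forall J : {set T}, J \subset A -> #|J| <= r (\bigcup_(a in J) S a)) ->
  exists f : T -> E, (forall a, a \in A -> f a \in S a) /\
    (forall J : {set T}, J \subset A -> #|J| <= r (f @: J)).
Proof.
have [m] := ubnP (\sum_(a in A) #|S a|); elim: m S => // m IHm S le_m hallS.
have [/exists_inP[a Aa Sa_gt1] | /exists_inPn Sle1] :=
  boolP [exists a in A, 1 < #|S a|]; last first.
  have S1 a : a \in A -> S a = [set odflt x0 [pick x in S a]].
    move=> Aa; case: pickP => [x Sx | S0] /=.
      apply/eqP; rewrite eq_sym eqEcard sub1set Sx cards1 leqNgt.
      exact: Sle1.
    have := hallS [set a]; rewrite sub1set Aa cards1 big_set1 => /(_ isT).
    have -> : S a = set0 by apply/setP=> x; rewrite inE; exact: S0.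
    by rewrite r0.
  exists (fun a => odflt x0 [pick x in S a]); split=> [a Aa | J sJA].
    by rewrite [in X in _ \in X](S1 a Aa) inE.
  apply: leq_trans (hallS J sJA) _; apply: rS; apply/bigcupsP=> a Ja.
  by rewrite (S1 a (subsetP sJA a Ja)) sub1set; apply/imsetP; exists a.
have [x [y [Sx Sy neq_xy]]] := card_gt1P Sa_gt1.
(* D z is the family S with z removed from the single set S a. *)
pose D z b := if b == a then S a :\ z else S b.
have DS z b : D z b \subset S b.
  by rewrite /D; case: eqP => [->|_]; rewrite ?subsetDl.
suffices [z Sz hallD] : exists2 z, z \in S a & forall J : {set T}, J \subset A ->
    #|J| <= r (\bigcup_(b in J) D z b).
  have [|f [fD hallf]] := IHm (D z) _ hallD.
    rewrite -ltnS; apply: leq_trans le_m; rewrite ltnS.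
    rewrite (bigD1 a Aa) [X in _ < X](bigD1 a Aa) /= -addSn.
    apply: leq_add; first by rewrite /D eqxx (cardsD1 z (S a)) Sz.
    by apply: leq_sum => b _; apply/subset_leq_card/DS.
  by exists f; split=> // b Ab; apply: subsetP (DS z b) _ (fD b Ab).
pose ok z := [forall J : {set T}, (J \subset A) ==>
  (#|J| <= r (\bigcup_(b in J) D z b))].
have okP z : ok z -> forall J : {set T}, J \subset A ->
    #|J| <= r (\bigcup_(b in J) D z b).
  by move=> /forallP okz J; apply/implyP.
have [/okP|] := boolP (ok x); first by exists x.
have [/okP|] := boolP (ok y); first by exists y.
rewrite !negb_forall => /existsP[J2]; rewrite negb_imply -ltnNge.
move=> /andP[sJ2A ltJ2] /existsP[J1]; rewrite negb_imply -ltnNge.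
move=> /andP[sJ1A ltJ1]; exfalso.
(* A violation of the reduced condition must involve the reduced set. *)
have inJ z (J : {set T}) : J \subset A -> r (\bigcup_(b in J) D z b) < #|J| -> a \in J.
  move=> sJA; apply: contraLR => aJ; rewrite -leqNgt.
  rewrite (eq_bigr S) ?hallS // => b Jb; rewrite /D; case: eqP => // eba.
  by rewrite -eba Jb in aJ.
have J1a := inJ _ _ sJ1A ltJ1; have J2a := inJ _ _ sJ2A ltJ2.
have hU := hallS (J1 :|: J2); have hI := hallS ((J1 :&: J2) :\ a).
(* Over a itself, the two reduced copies of S a still cover S a as x != y. *)
have sU : \bigcup_(b in J1 :|: J2) S b
    \subset (\bigcup_(b in J1) D x b) :|: (\bigcup_(b in J2) D y b).
  apply/bigcupsP=> b; have [-> _ | nba] := eqVneq b a.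
    apply/subsetP=> z Sz; rewrite inE; have [ezx | nzx] := eqVneq z x.
      apply/orP; right; apply/bigcupP; exists a => //.
      by rewrite /D eqxx !inE Sz ezx neq_xy.
    apply/orP; left; apply/bigcupP; exists a => //.
    by rewrite /D eqxx !inE Sz nzx.
  have Db z : S b = D z b by rewrite /D (negPf nba).
  rewrite inE => /orP[] Jb.
    by rewrite (Db x); apply: subset_trans (subsetUl _ _); apply: bigcup_sup.
  by rewrite (Db y); apply: subset_trans (subsetUr _ _); apply: bigcup_sup.
have sI : \bigcup_(b in (J1 :&: J2) :\ a) S b
    \subset (\bigcup_(b in J1) D x b) :&: (\bigcup_(b in J2) D y b).
  apply/bigcupsP=> b; rewrite !inE => /and3P[nba J1b J2b].
  have Db z : S b = D z b by rewrite /D (negPf nba).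
  by rewrite subsetI {1}(Db x) {1}(Db y); apply/andP; split; apply: bigcup_sup.
have {}hU := leq_trans (hU _) (rS _ _ sU).
have {}hI := leq_trans (hI _) (rS _ _ sI).
have sJU : J1 :|: J2 \subset A by rewrite subUset sJ1A.
have sJI : (J1 :&: J2) :\ a \subset A.
  by apply: subset_trans (subsetDl _ _) _; apply: subset_trans (subsetIl _ _) _.
have := r_submod (\bigcup_(b in J1) D x b) (\bigcup_(b in J2) D y b).
have := cardsUI J1 J2; have := cardsD1 a (J1 :&: J2); rewrite inE J1a J2a /=.
by move: {hU hI} (hU sJU) (hI sJI) ltJ1 ltJ2; clear; lia.
Qed.

(** Rado's theorem applied to the pairs (element, colour), each element a
    choosing among the pairs (a, i), with r summed over the colours: a set J of
    elements sees every colour, whence the factor k.+1. *)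
Lemma submodular_coloring (T : finType) (k : nat) (r : {set T} -> nat)
    (r0 : r set0 = 0)
    (rS : forall X Y : {set T}, X \subset Y -> r X <= r Y)
    (r_submod : forall X Y, r (X :|: Y) + r (X :&: Y) <= r X + r Y)
    (A : {set T}) :
    (forall J : {set T}, J \subset A -> #|J| <= k.+1 * r J) ->
  exists c : T -> 'I_k.+1, forall i,
    #|[set a in A | c a == i]| <= r [set a in A | c a == i].
Proof.
move=> rA; have [->|[a0 _]] := set_0Vmem A.
  exists (fun=> ord0) => i; suff -> : [set a in set0 | ord0 == i] = set0 :> {set T}.
    by rewrite cards0.
  by apply/setP=> a; rewrite !inE.
pose slice (X : {set T * 'I_k.+1}) i := [set a | (a, i) \in X].
pose R X := \sum_i r (slice X i).
pose S (a : T) : {set T * 'I_k.+1} := setX [set a] setT.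
have R0 : R set0 = 0.
  rewrite /R big1 // => i _; rewrite -r0; congr r.
  by apply/setP=> a; rewrite !inE.
have RS (X Y : {set T * 'I_k.+1}) : X \subset Y -> R X <= R Y.
  move=> sXY; apply: leq_sum => i _; apply: rS; apply/subsetP=> a.
  by rewrite !inE; apply: (subsetP sXY).
have R_submod X Y : R (X :|: Y) + R (X :&: Y) <= R X + R Y.
  rewrite /R -!big_split /=; apply: leq_sum => i _.
  have -> : slice (X :|: Y) i = slice X i :|: slice Y i.
    by apply/setP=> a; rewrite !inE.
  have -> : slice (X :&: Y) i = slice X i :&: slice Y i.
    by apply/setP=> a; rewrite !inE.
  exact: r_submod.
have sliceS (J : {set T}) i : slice (\bigcup_(a in J) S a) i = J.
  apply/setP=> a; rewrite !inE; apply/bigcupP/idP => [[b Jb] | Ja].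
    by rewrite !inE andbT => /eqP /= ->.
  by exists a; rewrite ?inE ?eqxx.
have [|f [fS hallf]] := rado_transversal (a0, ord0) R0 RS R_submod (A := A) (S := S).
  move=> J sJA; rewrite /R (eq_bigr (fun=> r J)) => [|i _]; last by rewrite sliceS.
  by rewrite sum_nat_const card_ord; apply: rA.
exists (fun a => (f a).2) => i; set J := [set a in A | _].
have sJA : J \subset A by apply/subsetP=> a; rewrite inE => /andP[].
have fJ a : a \in J -> f a = (a, i).
  rewrite inE => /andP[/fS]; rewrite !inE andbT => /eqP f1 /eqP f2.
  by rewrite [f a]surjective_pairing f1 f2.
have sliceJ j : slice (f @: J) j = if j == i then J else set0.
  apply/setP=> a; rewrite inE; apply/imsetP/idP => [[b Jb] | ].
    by rewrite fJ // => -[-> ->]; rewrite eqxx.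
  by case: eqP => [-> Ja | _]; [exists a; rewrite ?fJ | rewrite inE].
apply: leq_trans (hallf J sJA) _; rewrite /R (bigD1 i) //= sliceJ eqxx.
by rewrite big1 ?addn0 // => j /negPf nji; rewrite sliceJ nji.
Qed.

(** * Size of generated subgroups as a submodular function *)

(** For an elementary abelian p-group V this is the dimension of the span of B.
    For any p-group V, if <<M>> contains the p-th multiples of the elements of
    B, then log_span p (M :|: B) - log_span p M is the dimension of the F_p-space
    <<M :|: B>> / <<M>>; the lemmas below let it serve as a rank function
    without forming that quotient. *)
Definition log_span (p : nat) (V : finZmodType) (B : {set V}) : nat :=
  logn p #|<<B>>|.

Lemma log_spanS p (V : finZmodType) (B C : {set V}) :
  B \subset C -> log_span p B <= log_span p C.
Proof. by move=> sBC; rewrite dvdn_leq_log ?cardSg ?genS. Qed.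

Lemma mul_gen_setU (V : finZmodType) (B C : {set V}) :
  (<<B>> * <<C>>)%g = <<B :|: C>>.
Proof.
rewrite -cent_joinEr ?joing_idl ?joing_idr //.
by apply: (sub_abelian_cent2 (FinRing.zmod_abelian [set: V])); apply: subsetT.
Qed.

(** The subgroup generated by a union is a product of subgroups X and Y, with
    #|X * Y| * #|X :&: Y| = #|X| * #|Y|; the generators of the intersection may
    generate less than X :&: Y, hence only an inequality. *)
Lemma log_span_submod p (V : finZmodType) (B C : {set V}) :
  log_span p (B :|: C) + log_span p (B :&: C) <= log_span p B + log_span p C.
Proof.
rewrite /log_span -!lognM ?cardG_gt0 // [X in _ <= logn _ X]mul_cardG mul_gen_setU.
rewrite dvdn_leq_log ?muln_gt0 ?cardG_gt0 //= dvdn_mul //.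
by apply: cardSg; rewrite subsetI !genS ?subsetIl ?subsetIr.
Qed.

Lemma log_span_setU1 p (V : finZmodType) (b : V) (B : {set V}) :
  prime p -> (b *+ p)%R \in <<B>> -> log_span p (b |: B) <= (log_span p B).+1.
Proof.
move=> p_pr pbB.
have dvd_b : #[b] %| p * #[(b ^+ p)%g].
  by rewrite order_dvdn expgM expg_order.
have dvd_I : #[(b ^+ p)%g] %| #|<[b]> :&: <<B>>|.
  by apply: cardSg; rewrite cycle_subG inE mem_cycle.
have dvd_span : #|<<b |: B>>| %| p * #|<<B>>|.
  rewrite -(@dvdn_pmul2r #|<[b]> :&: <<B>>|) ?cardG_gt0 //.
  rewrite -mul_gen_setU -mul_cardG mulnAC dvdn_mul //.
  exact: dvdn_trans dvd_b (dvdn_mul (dvdnn p) dvd_I).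
have p_gt0 := prime_gt0 p_pr.
have := dvdn_leq_log p _ dvd_span; rewrite muln_gt0 p_gt0 cardG_gt0.
by rewrite lognM ?cardG_gt0 // (logn_prime p p_pr) eqxx; apply.
Qed.

Lemma log_span_setU p (V : finZmodType) (K B : {set V}) :
  prime p -> (forall b, b \in B -> (b *+ p)%R \in <<K>>) ->
  log_span p (K :|: B) <= log_span p K + #|B|.
Proof.
move=> p_pr; have [m] := ubnP #|B|; elim: m B => // m IHm B le_m pBK.
have [->|[b Bb]] := set_0Vmem B; first by rewrite setU0 leq_addr.
rewrite (cardsD1 b) Bb addnA addn1 -{1}(setD1K Bb) setUCA.
apply: leq_trans (log_span_setU1 p_pr _) _.
  by apply: subsetP (pBK b Bb); rewrite genS ?subsetUl.
rewrite addSn ltnS IHm //.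
  by move: le_m; rewrite (cardsD1 b) Bb.
by move=> c /setD1P[_]; exact: pBK.
Qed.

(** Each of the s quotients of the chain N, pN, p^2 N, ... is elementary abelian
    of rank at most 'r_p(N), as |N| = |'Ohm_1(N)| |pN| and the rank of an
    abelian group is that of its 'Ohm_1. *)
Lemma logn_card_le_p_rank (p s : nat) (gT : finGroupType) (N : {group gT}) :
  p.-group N -> abelian N -> exponent N %| p ^ s ->
  logn p #|N| <= s * 'r_p(N).
Proof.
elim: s N => [|s IHs] N pN abN expN.
  by move: expN; rewrite expn0 -trivg_exponent mul0n => /eqP->; rewrite cards1 logn1.
rewrite -(mul_card_Ohm_Mho_abelian 1 abN) lognM ?cardG_gt0 //.
rewrite -p_rank_abelian // mulSn leq_add2l.
apply: leq_trans (leq_mul (leqnn s) (p_rankS p (Mho_sub 1 N))).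
apply: IHs; [exact: pgroupS (Mho_sub 1 N) pN | exact: abelianS (Mho_sub 1 N) abN |].
apply/exponentP => x; rewrite /= (MhoEabelian 1 pN abN) expn1 => /imsetP[y Ny ->].
by rewrite -expgM -expnS; apply: (exponentP expN).
Qed.

(** * Independence modulo a subgroup *)

Definition independent_mod (V : finZmodType) (H Q : {set V}) : Prop :=
  forall eps : V -> int,
    (forall a, a \in Q -> eps a \in [:: -1; 0; 1]%R) ->
    (\sum_(a in Q) a *~ eps a)%R \in H ->
    forall a, a \in Q -> eps a = 0%R.

Lemma sum_in_span (V : finZmodType) (B : {set V}) (eps : V -> int) :
  (\sum_(a in B) a *~ eps a)%R \in <<B>>.
Proof.
apply: (big_ind (fun x : V => x \in <<B>>)) => [|x y|a Ba].
- exact: group1.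
- exact: groupM.
have Ba' : a \in <<B>> by apply: mem_gen.
case: (eps a) => n; first by rewrite -[(_ *~ _)%R]/(a ^+ n)%g groupX.
by rewrite -[(_ *~ _)%R]/((a ^+ n.+1)^-1)%g groupV groupX.
Qed.

(** In a nontrivial relation modulo <<M>> some b occurs with coefficient 1 or
    -1, so b is generated by M and the rest of Q. Then Q increases log_span by
    at most #|Q| - 1, because each element increases it by at most one. *)
Lemma independent_mod_log_span p (V : finZmodType) (M Q : {set V}) :
  prime p -> (forall b, b \in Q -> (b *+ p)%R \in <<M>>) ->
  #|Q| + log_span p M <= log_span p (M :|: Q) -> independent_mod <<M>> Q.
Proof.
move=> p_pr pQM rQ eps eps1 sumM b Qb; apply/eqP; apply: contraLR rQ => eps_b.
have pQbM c : c \in Q :\ b -> (c *+ p)%R \in <<M>>.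
  by move=> /setD1P[_]; exact: pQM.
have b_in : b \in <<M :|: Q :\ b>>.
  have: (b *~ eps b)%R \in <<M :|: Q :\ b>>.
    have -> : (b *~ eps b = \sum_(a in Q) a *~ eps a -
                        \sum_(a in Q :\ b) a *~ eps a)%R.
      by rewrite (big_setD1 b Qb) /= addrK.
    apply: groupM; last rewrite groupV.
      by apply: subsetP sumM; rewrite genS ?subsetUl.
    by apply: subsetP (sum_in_span _ _); rewrite genS ?subsetUr.
  move: (eps1 b Qb) eps_b; rewrite !inE => /or3P[] /eqP-> //.
  by rewrite mulrNz mulr1z groupV.
have same_span : log_span p (M :|: Q) = log_span p (M :|: Q :\ b).
  congr (logn p #|pred_of_set _|); apply/eqP; rewrite eqEsubset andbC.
  rewrite genS ?setUS ?subsetDl // gen_subG -{1}(setD1K Qb) setUCA subUset.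
  by rewrite sub1set b_in subset_gen.
rewrite same_span -ltnNge (cardsD1 b Q) Qb.
by rewrite -addnA add1n ltnS addnC; apply: log_span_setU.
Qed.

Lemma independent_mod_setU (V : finZmodType) (M Q H : {set V}) :
  H \subset <<M>> -> [disjoint Q & H] -> independent_mod <<M>> Q ->
  quasi_independent H -> quasi_independent (Q :|: H).
Proof.
move=> sHM dQH indQ qiH eps eps1 sum0.
have eps1Q a : a \in Q -> eps a \in [:: -1; 0; 1]%R.
  by move=> Qa; apply: eps1; rewrite inE Qa.
have eps1H a : a \in H -> eps a \in [:: -1; 0; 1]%R.
  by move=> Ha; apply: eps1; rewrite inE Ha orbT.
move: sum0; rewrite (eq_bigl (fun i => (i \in Q) || (i \in H))); last first.
  by move=> i; rewrite inE.
rewrite bigU //= => sum0.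
have epsQ : forall a, a \in Q -> eps a = 0%R.
  apply: indQ => //; move/eqP: sum0; rewrite addr_eq0 => /eqP->.
  by rewrite groupV; apply: subsetP (sum_in_span H _); rewrite gen_subG.
move: sum0; rewrite big1 => [|a Qa]; last by rewrite epsQ.
rewrite add0r => sum0 a /setUP[/epsQ //|]; exact: qiH.
Qed.

(** * Colouring into quasi-independent sets *)

Lemma independent_coloring (p k : nat) (V : finZmodType) (M C : {set V}) :
    prime p -> (forall a, a \in C -> (a *+ p)%R \in <<M>>) ->
    (forall J : {set V}, J \subset C ->
      #|J| <= k.+1 * (log_span p (M :|: J) - log_span p M)) ->
  exists c : V -> 'I_k.+1, forall i,
    independent_mod <<M>> [set a in C | c a == i].
Proof.
move=> p_pr pCM largeC.
pose r J := log_span p (M :|: J) - log_span p M.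
have leM J : log_span p M <= log_span p (M :|: J).
  by apply: log_spanS; apply: subsetUl.
have [|X Y sXY|X Y||c hc] := @submodular_coloring V k r _ _ _ C.
- by rewrite /r setU0 subnn.
- by rewrite leq_sub2r // log_spanS // setUS.
- have := log_span_submod p (M :|: X) (M :|: Y).
  rewrite -setUUr -setUIr; have := leM X; have := leM Y.
  by have := leM (X :|: Y); have := leM (X :&: Y); rewrite /r; clear; lia.
- exact: largeC.
exists c => i; apply: independent_mod_log_span p_pr _ _ => [b|].
  by rewrite inE => /andP[Cb _]; apply: pCM.
by rewrite addnC -leq_subRL ?leM // hc.
Qed.

(** The peeling argument. At each stage a set A :\: H is coloured modulo the
    subgroup generated by H and by the p-th multiples of <<A>>, and the
    colouring of H comes from the induction hypothesis. *)
Lemma quasi_independent_coloring (p k : nat) (V : finZmodType) (A : {set V}) :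
    prime p -> p.-group [set: V] ->
    (forall B : {set V}, B \subset A -> #|B| <= k.+1 * 'r_p(<<B>>)) ->
  exists c : V -> 'I_k.+1, forall i, quasi_independent [set a in A | c a == i].
Proof.
move=> p_pr pV; have [m] := ubnP #|A|; elim: m A => // m IHm A le_m largeA.
have [A0 | A_neq0] := eqVneq A set0.
  by exists (fun=> ord0) => i eps _ _ a; rewrite A0 !inE.
pose K : {set V} := 'Mho^1(<<A>>).
have pN : p.-group <<A>> := pgroupS (subsetT _) pV.
have abN : abelian <<A>> by apply: abelianS (subsetT _) (FinRing.zmod_abelian _).
have pK a : a \in A -> (a *+ p)%R \in K.
  move=> Aa; have Na : a \in <<A>> by apply: mem_gen.
  by have := Mho_p_elt 1 Na (mem_p_elt pN Na); rewrite expn1.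
pose L H := log_span p (K :|: H).
have LS (H J : {set V}) : H \subset J -> L H <= L J by move=> sHJ; rewrite log_spanS ?setUS.
have rank_eq : 'r_p(<<A>>) = L A - L set0.
  have -> : L A = logn p #|<<A>>|.
    congr (logn p #|pred_of_set _|); apply/eqP; rewrite eqEsubset.
    by rewrite gen_subG subUset Mho_sub subset_gen genS ?subsetUr.
  have -> : L set0 = logn p #|'Mho^1(<<A>>)|.
    by rewrite /L setU0 /log_span genGid.
  rewrite -(mul_card_Ohm_Mho_abelian 1 abN) lognM ?cardG_gt0 //.
  by rewrite addnK p_rank_abelian.
have proper0 : set0 \proper A by rewrite proper0.
pose val (H : {set V}) := #|H| + k.+1 * (L A - L H).
(* H has to be proper for the induction to progress; val_le shows that this
   restriction does not lower the maximum. *)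
have [H prHA maxH] := @arg_maxnP _ set0 (fun H => H \proper A) val proper0.
have sHA := proper_sub prHA.
have val_le (J : {set V}) : H \subset J -> J \subset A -> val J <= val H.
  move=> sHJ sJA; have [-> | neqJA] := eqVneq J A; last first.
    by apply: maxH; rewrite properEneq neqJA.
  apply: leq_trans (maxH set0 proper0).
  by rewrite /val subnn muln0 addn0 cards0 add0n -rank_eq largeA.
have [c1 indc1] : exists c : V -> 'I_k.+1, forall i,
    independent_mod <<K :|: H>> [set a in A :\: H | c a == i].
  apply: independent_coloring p_pr _ _ => [a /setDP[Aa _] | J sJ].
    by rewrite mem_gen // inE pK.
  have sJA : J \subset A by apply: subset_trans sJ (subsetDl _ _).
  have dHJ : [disjoint H & J].
    by rewrite disjoint_sym; move: sJ; rewrite subsetD => /andP[].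
  have sHJA : H :|: J \subset A by rewrite subUset sHA.
  have := val_le _ (subsetUl H J) sHJA; rewrite /val cardsU disjoint_setI0 //.
  rewrite cards0 subn0 -setUA -/(L H) -/(L (H :|: J)).
  have := LS _ _ (subsetUl H J); have := LS _ _ sHJA; rewrite -addnA leq_add2l.
  clear; move: (L H) (L A) (L _) => x y z lzy lxz.
  move=> hJ; rewrite -(leq_add2r (k.+1 * (y - z))); apply: leq_trans hJ _.
  by rewrite -mulnDr; apply/eq_leq; congr (_ * _); lia.
have [|B sBH|c2 qic2] := IHm H.
- by apply: leq_trans (proper_card prHA) _; rewrite -ltnS.
- by apply: largeA; apply: subset_trans sHA.
exists (fun a => if a \in H then c2 a else c1 a) => i.
have -> : [set a in A | (if a \in H then c2 a else c1 a) == i] =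
    [set a in A :\: H | c1 a == i] :|: [set a in H | c2 a == i].
  apply/setP=> a; rewrite !inE; case: ifP => [Ha|_]; last by rewrite orbF.
  by rewrite (subsetP sHA).
apply: independent_mod_setU (indc1 i) (qic2 i).
  apply: subset_trans (subset_gen _); apply: subset_trans (subsetUr _ _).
  by apply/subsetP=> a; rewrite inE => /andP[].
by rewrite -setI_eq0; apply/eqP/setP=> a; rewrite !inE; case: (a \in H); rewrite ?andbF.
Qed.

(** * Size of the subgroup generated by a quasi-independent set *)

(** If two subsets of Q had the same sum, the difference of their indicator
    functions would be a nontrivial relation with coefficients -1, 0, 1. *)
Lemma quasi_independent_card (V : finZmodType) (Q : {set V}) :
  quasi_independent Q -> 2 ^ #|Q| <= #|<<Q>>|.
Proof.
move=> qiQ; rewrite -card_powerset.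
pose sigma (X : {set V}) : V := (\sum_(a in Q) a *~ (a \in X)%:Z)%R.
have sigma_inj : {in powerset Q &, injective sigma}.
  move=> X Y; rewrite !inE => sXQ sYQ eqXY.
  have eps0 : forall a, a \in Q -> ((a \in X)%:Z - (a \in Y)%:Z = 0)%R.
    apply: qiQ => [a _|]; first by do 2 case: (_ \in _).
    rewrite (eq_bigr (fun a => a *~ (a \in X)%:Z - a *~ (a \in Y)%:Z)%R).
      by rewrite sumrB -/(sigma X) -/(sigma Y) eqXY subrr.
    by move=> a _; rewrite mulrzBr.
  apply/setP=> a; have [Qa | nQa] := boolP (a \in Q).
    by have := eps0 a Qa; do 2 case: (_ \in _).
  by rewrite (contraNF (subsetP sXQ a) nQa) (contraNF (subsetP sYQ a) nQa).
rewrite -(card_in_imset sigma_inj); apply: subset_leq_card.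
by apply/subsetP=> _ /imsetP[X _ ->]; apply: sum_in_span.
Qed.

End Coloring.

(** * The theorem *)

Local Open Scope ring_scope.

Lemma log2_bound_of_card (R : realType) (p m e : nat) : prime p ->
  (2 ^ m <= p ^ e)%N -> m%:R <= e%:R * log2 (p%:R : R).
Proof.
move=> p_pr le2p; have ln2_gt0 : 0 < ln (2 : R) by rewrite ln_gt0 // ltr1n.
have p_gt0 : 0 < (p%:R : R) by rewrite ltr0n prime_gt0.
rewrite /log2 mulrA ler_pdivlMr // !mulr_natl -!lnXn //.
by rewrite ler_ln ?posrE ?exprn_gt0 // -!natrX ler_nat.
Qed.

Lemma exponent_Zq_rV (q n : nat) : (1 < q)%N ->
  (exponent [set: 'rV['Z_q]_n] %| q)%N.
Proof.
move=> q_gt1; apply/exponentP => x _; rewrite -[LHS]/(x *+ q).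
by apply/rowP=> i; rewrite mulmxnE mxE -mulr_natl pchar_Zp ?mul0r.
Qed.

Theorem theorem1p3 (R : realType) (p s q n : nat)
    (p_prime : prime p) (s_ge1 : (1 <= s)%N) (q_def : q = (p ^ s)%N)
    (delta : R) (delta_gt0 : 0 < delta) (A : {set 'rV['Z_q]_n})
    (large_qi : forall B : {set 'rV['Z_q]_n}, B \subset A ->
       exists Q : {set 'rV['Z_q]_n},
         [/\ Q \subset B, quasi_independent Q &
             delta * (#|B|%:R : R) <= #|Q|%:R]) :
  exists (k : nat) (A_ : 'I_k -> {set 'rV['Z_q]_n}),
    [/\ k%:Z <= Num.ceil (s%:R * log2 (p%:R : R) / delta),
        A = \bigcup_(i < k) A_ i,
        forall i j : 'I_k, i != j -> [disjoint A_ i & A_ j] &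
        forall i : 'I_k, quasi_independent (A_ i)].
Proof.
have q_gt1 : (1 < q)%N.
  by rewrite q_def -(exp1n s) ltn_exp2r // prime_gt1.
pose V : finZmodType := 'rV['Z_q]_n.
have expV : (exponent [set: V] %| p ^ s)%N by rewrite -q_def exponent_Zq_rV.
have pV : (p.-group [set: V])%g.
  by rewrite -pnat_exponent (pnat_dvd expV) // pnatX pnat_id.
set x := s%:R * log2 p%:R / delta.
have x_gt0 : 0 < x.
  rewrite divr_gt0 // mulr_gt0 ?ltr0n // divr_gt0 // ln_gt0 ?ltr1n //.
  exact: prime_gt1.
have x_le := Num.Theory.ceil_ge x.
have ceil_gt0 : 0 < Num.ceil x by rewrite -(ltr0z R) (lt_le_trans x_gt0).
case: (Num.ceil x) ceil_gt0 x_le => [[|k]|] // _ x_le.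
(* Condition (1) above, with k.+1 colours. *)
have largeA (B : {set V}) : B \subset A -> (#|B| <= k.+1 * 'r_p(<<B>>)%g)%N.
  move=> sBA; have [Q [sQB qiQ leQ]] := large_qi B sBA.
  have pB : (p.-group <<B>>)%g := pgroupS (subsetT _) pV.
  have le_card : (2 ^ #|Q| <= p ^ (s * 'r_p(<<B>>)%g))%N.
    apply: leq_trans (quasi_independent_card qiQ) _.
    apply: leq_trans (subset_leq_card (genS sQB)) _.
    rewrite (card_pgroup pB) leq_exp2l ?prime_gt1 //.
    apply: logn_card_le_p_rank => //.
      by apply: abelianS (subsetT _) (FinRing.zmod_abelian _).
    exact: dvdn_trans (exponentS (subsetT _)) expV.
  have := le_trans leQ (log2_bound_of_card R p_prime le_card).
  rewrite -(ler_nat R) natrM mulrC -ler_pdivlMr // => /le_trans-> //.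
  rewrite natrM -mulrA mulrCA -mulrA -/x mulrC ler_wpM2r //.
have [c qic] := quasi_independent_coloring p_prime pV largeA.
exists k.+1, (fun i => [set a in A | c a == i]); split=> //.
- apply/setP=> a; apply/idP/bigcupP => [Aa | [i _]].
    by exists (c a); rewrite ?inE ?Aa /=.
  by rewrite inE => /andP[].
- move=> i j; apply: contraR => /pred0Pn[a] /=; rewrite !inE.
  by move=> /andP[/andP[_ /eqP<-] /andP[_ /eqP<-]].
Qed.
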